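(* Let $d\ge1$ and $1\le l\le d$. For every $\omega\in L^2\Lambda^l(\Omega)$, \[ \|\mathcal H\omega\|_{L^2\Lambda^{l-1}(\Omega)}\le\frac1\pi\,\|\omega\|_{L^2\Lambda^l(\Omega)}. \]
   Context: $\Omega=(0,1)^d$, $[d]=\{1,\dots,d\}$. For $I=\{i_1<\dots<i_l\}\subseteq[d]$ put $\mathrm dx_I=\mathrm dx_{i_1}\wedge\cdots\wedge\mathrm dx_{i_l}$. $L^2\Lambda^l(\Omega)$ is the space of $l$-forms $\omega=\sum_{|I|=l}u_I\,\mathrm dx_I$ with $u_I\in L^2(\Omega)$, with $\|\omega\|_{L^2\Lambda^l(\Omega)}^2=\sum_{|I|=l}\|u_I\|_{L^2(\Omega)}^2$. For $q\in L^2(0,1)$ let $Aq(x)=\int_0^xq(t)\,\mathrm dt-\int_0^1\int_0^yq(t)\,\mathrm dt\,\mathrm dy$, and let $A_i$ be $A$ acting only in the variable $x_i$. For $i\in[d]$ define, extended linearly to forms: $p_i(u_I\,\mathrm dx_I)=\big(\int_0^1u_I(x_1,\dots,t,\dots,x_d)\,\mathrm dt\big)\mathrm dx_I$ ($t$ in the $i$th slot) if $i\notin I$, and $p_i(u_I\,\mathrm dx_I)=0$ if $i\in I$; $h_i(u_I\,\mathrm dx_I)=0$ if $i\notin I$, and $h_i(u_I\,\mathrm dx_I)=(-1)^{r-1}(A_iu_I)\,\mathrm dx_{I\setminus\{i\}}$ if $i=i_r$ is the $r$th element of the ordered set $I$. Put $P_{<1}=\mathrm{id}$, $P_{<i}=p_1\cdots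 p_{i-1}$, and $\mathcal H=\sum_{i=1}^dP_{<i}h_i$. *)

(* Defs.v *)
From HB Require Import structures.
From mathcomp Require Import all_boot all_order all_algebra.
From mathcomp Require Import all_classical all_reals all_analysis.

Set Implicit Arguments.
Unset Strict Implicit.
Unset Printing Implicit Defensive.
Import Order.TTheory GRing.Theory Num.Theory.
Import numFieldNormedType.Exports.
Local Open Scope classical_set_scope.
Local Open Scope ring_scope.

Notation Rn R d := (d.-tuple (measurableTypeR R)).

Section lebesgue_tuple.
Variable R : realType.

Definition tcons n (x : measurableTypeR R * Rn R n) : Rn R n.+1 :=
  [tuple of x.1 :: x.2].

Definition tuncons n (x : Rn R n.+1) : measurableTypeR R * Rn R n :=
  (thead x, [tuple of behead x]).

Lemma tconsK n : cancel (@tcons n) (@tuncons n).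
Proof.
by move=> [x y]; rewrite /tuncons /tcons /= theadE; congr pair; exact/val_inj.
Qed.

Lemma measurable_tcons n : measurable_fun [set: _] (@tcons n).
Proof. exact: (measurable_cons measurable_fst measurable_snd). Qed.

Lemma measurable_tuncons n : measurable_fun [set: _] (@tuncons n).
Proof.
by apply: measurable_fun_pair; [exact: measurable_tnth|exact: measurable_behead].
Qed.

Definition box n (A : 'I_n -> set (measurableTypeR R)) : set (Rn R n) :=
  [set x | forall i, A i (tnth x i)].

Lemma measurable_box n (A : 'I_n -> set (measurableTypeR R)) :
  (forall i, measurable (A i)) -> measurable (box A).
Proof.
move=> mA.
rewrite (_ : box A = \bigcap_(i in setT) ((@tnth _ _ ^~ i) @^-1` A i)).
  apply: fin_bigcap_measurable => [|i _]; first exact: finite_finset.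
  by rewrite -[X in measurable X]setTI; exact: measurable_tnth.
by apply/seteqP; split => x Ax i => [_|]; exact: Ax.
Qed.

Section lebesgue_cons.
Variables (n : nat) (mu : {sigma_finite_measure set (Rn R n) -> \bar R}).

(* The product of the Lebesgue measure on R and [mu], seen on (n+1)-tuples. *)
Definition lebesgue_cons : set (Rn R n.+1) -> \bar R :=
  pushforward (lebesgue_measure \x mu)%E (@tcons n).

HB.instance Definition _ := Measure.copy lebesgue_cons
  (measure_function_pushforward__canonical__measure_function_Measure
     (lebesgue_measure \x mu)%E (@measurable_tcons n)).

Let lebesgue_cons_sigma_finite : sigma_finite setT lebesgue_cons.
Proof.
have /sigma_finiteP[F [TF ndF Foo]] := sigma_finiteT (@lebesgue_measure R).
have /sigma_finiteP[G [TG ndG Goo]] := sigma_finiteT mu.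
exists (fun k => @tuncons n @^-1` (F k `*` G k)).
  rewrite -preimage_bigcup; apply/esym; rewrite -subTset => x _ /=.
  have [[k _ Fk] [m _ Gm]] : (\bigcup_k F k) (tuncons x).1 /\
      (\bigcup_k G k) (tuncons x).2 by rewrite -TF -TG.
  exists (maxn k m) => //; split.
    by move: Fk; exact/subsetPset/ndF/leq_maxl.
  by move: Gm; exact/subsetPset/ndG/leq_maxr.
move=> k; have [mF Fk] := Foo k; have [mG Gk] := Goo k.
split.
  by rewrite -[X in measurable X]setTI; apply: measurable_tuncons => //;
    exact: measurableX.
rewrite /lebesgue_cons /pushforward -comp_preimage.
rewrite (_ : _ \o _ = id); last by apply/funext => x /=; rewrite tconsK.
by rewrite preimage_id product_measure1E// lte_mul_pinfty// ge0_fin_numE.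
Qed.

HB.instance Definition _ :=
  Measure_isSigmaFinite.Build _ _ _ lebesgue_cons lebesgue_cons_sigma_finite.

End lebesgue_cons.

Fixpoint lebesgue_tuple n : {sigma_finite_measure set (Rn R n) -> \bar R} :=
  match n with
  | 0 => \d_ [tuple]
  | n.+1 => lebesgue_cons (lebesgue_tuple n)
  end.

Lemma lebesgue_tuple_box n (A : 'I_n -> set (measurableTypeR R)) :
  (forall i, measurable (A i)) ->
  lebesgue_tuple n (box A) = (\prod_(i < n) lebesgue_measure (A i))%E.
Proof.
elim: n A => [|n IH] A mA.
  by rewrite big_ord0 /= diracE mem_set // => -[].
rewrite big_ord_recl -IH //= /lebesgue_cons /pushforward.
rewrite -product_measure1E //; last exact: measurable_box.
congr (product_measure1 _ _ _); apply/seteqP; split => -[x y] /=.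
  move=> Axy; split; first exact: (Axy ord0).
  by move=> i; have := Axy (lift ord0 i); rewrite tnthS.
move=> [Ax Ay] i; case: (unliftP ord0 i) => [j|] -> //.
by rewrite tnthS; exact: Ay.
Qed.

End lebesgue_tuple.

Section unit_cube.
Variables (R : realType) (d : nat).

Definition cube : set (Rn R d) := box (fun=> `]0, 1[%classic).

Lemma measurable_cube : measurable cube.
Proof. by apply: measurable_box => i; exact: measurable_itv. Qed.

Definition lebesgue_cube : set (Rn R d) -> \bar R :=
  mrestr (lebesgue_tuple R d) measurable_cube.

HB.instance Definition _ := Measure.on lebesgue_cube.

End unit_cube.
Arguments cube : clear implicits.
Arguments measurable_cube : clear implicits.
Arguments lebesgue_cube : clear implicits.

Section forms.
Variables (R : realType) (d : nat).

(* A form is the family of its coefficients: [w I] is the coefficient of dx_I,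
   with I ranging over the subsets of all cardinalities. Coefficients are total
   functions on R^d standing for their classes in L^2 of the cube; on the cube,
   the operators below depend only on the values of the coefficients there. *)
Definition dform := {set 'I_d} -> Rn R d -> R.

Implicit Types (w : dform) (u : Rn R d -> R) (i : 'I_d) (I : {set 'I_d}).

Definition L2form (l : nat) w : Prop :=
  (forall I, #|I| = l -> w I \in Lfun (lebesgue_cube R d) 2%:E) /\
  (forall I, #|I| <> l -> w I = 0).

Definition L2norm (l : nat) w : R :=
  Num.sqrt (\sum_(I : {set 'I_d} | #|I| == l)
    fine ('N[lebesgue_cube R d]_(2%:E)[EFin \o w I])%E ^+ 2).

Definition monomial u I : dform := fun J => if J == I then u else 0.

Definition set_coord i (t : R) (x : Rn R d) : Rn R d :=
  [tuple if j == i then t else tnth x j | j < d].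

Definition primitive (q : R -> R) (x : R) : R :=
  \int[lebesgue_measure]_(t in `]0, x[%classic) q t
  - \int[lebesgue_measure]_(y in `]0, 1[%classic)
      \int[lebesgue_measure]_(t in `]0, y[%classic) q t.

Definition primitive_coord i u : Rn R d -> R :=
  fun x => primitive (fun t => u (set_coord i t x)) (tnth x i).

Definition average_coord i u : Rn R d -> R :=
  fun x => \int[lebesgue_measure]_(t in `]0, 1[%classic) u (set_coord i t x).

Definition p_op i w : dform :=
  \sum_(I : {set 'I_d})
    if i \in I then 0 else monomial (average_coord i (w I)) I.

(* If i is the r-th element of I, exactly r - 1 elements of I are below i. *)
Definition h_op i w : dform :=
  \sum_(I : {set 'I_d})
    if i \in I then
      monomial ((-1) ^+ #|[set j in I | (j < i)%N]| *: primitive_coord i (w I))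
        (I :\ i)
    else 0.

(* p_1 (p_2 (... (p_(i-1) w))) *)
Definition p_below i w : dform :=
  foldr p_op w [seq j : 'I_d <- enum 'I_d | (j < i)%N].

Definition H_op w : dform := \sum_(i < d) p_below i (h_op i w).

End forms.

(* Main.v *)
Require Import Defs.
From HB Require Import structures.
From mathcomp Require Import all_boot all_order all_algebra.
From mathcomp Require Import all_classical all_reals all_analysis.
From mathcomp Require Import measurable_realfun.
From mathcomp Require Import ring lra.

(** In (H w)_J only the indices i < min J contribute, with sign +1, so
    (H w)_J = T_1 + p_1 (T_2 + p_2 (T_3 + ...)) almost everywhere, where T_i is
    A_i w_{J+i} if i < min J and 0 otherwise. On each line in direction i, A_i u
    has mean zero while p_i v is constant, so that
    |A_i u + p_i v|^2 <= pi^-2 |u|^2 + |v|^2, and by iteration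
    |(H w)_J|^2 <= pi^-2 sum_{i < min J} |w_{J+i}|^2. Each I is J + i with
    i < min J for exactly one pair (J, i), namely i = min I.

    In one variable, |A q|^2 is the quadratic form of the Dirichlet Green
    function min(s, t) - s t, a positive kernel with eigenfunction sin (pi t) for
    the eigenvalue pi^-2; the Schur test gives |A q| <= pi^-1 |q|. *)

Set Implicit Arguments.
Unset Strict Implicit.
Unset Printing Implicit Defensive.
Import Order.TTheory GRing.Theory Num.Theory.
Import numFieldNormedType.Exports.
Local Open Scope classical_set_scope.
Local Open Scope ring_scope.

(** * Slicing the cube *)

(** The Green function comes from the adjoint of A. Put f = A q and let phi t be the integral of f
    over (t, 1). Then phi' = -f and f' = q, and phi vanishes at 1 by definition and at 0 because f
    has mean zero. So the adjoint of A followed after A is the inverse of -u'' with Dirichlet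
    conditions, whose largest eigenvalue is pi^-2. Its positive eigenfunction, used as Schur weight,
    returns exactly this constant, and no spectral theorem enters.

    Two points shape the rest. [Rintegral] is additive only on integrable functions, so p_i
    distributes over a sum only on lines where all terms are integrable; this is why the nested
    formula is an almost everywhere identity. Squared norms are extended reals, so the bounds hold
    on every line for every measurable function and integrate by Tonelli, without setting the bad
    lines aside. *)

Section restriction.
Context d (T : measurableType d) (R : realType).
Variables (mu : {measure set T -> \bar R}) (D : set T) (mD : measurable D).
Local Open Scope ereal_scope.

Lemma integral_mrestrE (f : T -> \bar R) :
  \int[mrestr mu mD]_(x in D) f x = \int[mu]_(x in D) f x.
Proof.
apply: eq_measure_integral => A mA AD.
by rewrite /= /mrestr setIidl.
Qed.

Lemma ge0_integral_mrestr (f : T -> \bar R) : measurable_fun setT f ->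
  (forall x, 0 <= f x) -> \int[mrestr mu mD]_x f x = \int[mu]_(x in D) f x.
Proof.
move=> mf f0; rewrite -(setUv D) ge0_integral_setU//=.
- rewrite integral_mrestrE.
  rewrite [X in _ + X](eq_measure_integral mzero); last first.
    move=> A mA AD /=; rewrite /mrestr.
    rewrite (_ : A `&` D = set0) ?measure0 //.
    by rewrite -subset0 => x [/AD].
  by rewrite integral_measure_zero adde0.
- exact: measurableC.
- by rewrite setUv.
- by apply/disj_set2P; rewrite setICr.
Qed.

Lemma integral_mrestr (f : T -> \bar R) : measurable_fun setT f ->
  \int[mrestr mu mD]_x f x = \int[mu]_(x in D) f x.
Proof.
move=> mf; rewrite [LHS]integralE [RHS]integralE !ge0_integral_mrestr //.
- exact: measurable_funeneg.
- exact: measurable_funepos.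
Qed.

End restriction.

Section unit_measure.
Context (R : realType).

(** The domain is carried by the measure, as in [lebesgue_cube]: integrands stay total functions,
    and the total mass is 1, so bounded measurable functions are integrable and constants integrate
    to themselves. *)
Definition unit_leb : set (measurableTypeR R) -> \bar R :=
  mrestr (@lebesgue_measure R) (measurable_itv `]0, 1[).

HB.instance Definition _ := Measure.on unit_leb.

Lemma unit_leb_setT : unit_leb setT = 1%E.
Proof.
by rewrite /unit_leb /mrestr setTI lebesgue_measure_itv /= lte01 oppr0 adde0.
Qed.

HB.instance Definition _ :=
  Measure_isProbability.Build _ _ _ unit_leb unit_leb_setT.

Lemma unit_integralE (f : R -> \bar R) : measurable_fun setT f ->
  (\int[lebesgue_measure]_(t in `]0%R, 1%R[) f t = \int[unit_leb]_t f t)%E.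
Proof. by move=> mf; rewrite integral_mrestr. Qed.

Context (n : nat).

Lemma lebesgue_cube_setT : lebesgue_cube R n setT = 1%E.
Proof.
rewrite /lebesgue_cube /mrestr setTI lebesgue_tuple_box => [|i]; last first.
  exact: measurable_itv.
by rewrite big1 // => i _; rewrite lebesgue_measure_itv /= lte01 oppr0 adde0.
Qed.

HB.instance Definition _ :=
  Measure_isProbability.Build _ _ _ (lebesgue_cube R n) lebesgue_cube_setT.

End unit_measure.

Arguments unit_leb : clear implicits.

Section slicing.
Context (R : realType).
Local Open Scope ereal_scope.

Lemma ge0_integral_cubeS n (g : Rn R n.+1 -> \bar R) :
  measurable_fun setT g -> (forall x, 0 <= g x) ->
  \int[lebesgue_cube R n.+1]_x g x =
  \int[unit_leb R]_a \int[lebesgue_cube R n]_y g (tcons (a, y)).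
Proof.
move=> mg g0.
pose prd := (@lebesgue_measure R \x lebesgue_tuple R n).
pose I : set (measurableTypeR R) := `]0%R, 1%R[%classic.
have mD : measurable (I `*` cube R n).
  by apply: measurableX; [exact: measurable_itv|exact: measurable_cube].
have mc := @measurable_tcons R n.
have gc : measurable_fun setT (g \o @tcons R n) by exact: measurableT_comp.
rewrite (ge0_integral_mrestr _ (measurable_cube R n.+1)) //.
rewrite [LHS](ge0_integral_pushforward mc) //; last first.
- exact: measurable_funTS.
- exact: measurable_cube.
rewrite (_ : _ @^-1` _ = I `*` cube R n); last first.
  apply/seteqP; split => -[x y] /=.
    move=> Axy; split; first exact: (Axy ord0).
    by move=> i; have := Axy (lift ord0 i); rewrite tnthS.
  move=> [Ax Ay] i; case: (unliftP ord0 i) => [j|] -> //.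
  by rewrite tnthS; exact: Ay.
rewrite -(ge0_integral_mrestr _ mD) //.
(* Restriction commutes with the product: both measures agree on rectangles, and these determine the
   product measure. *)
rewrite (eq_measure_integral (unit_leb R \x lebesgue_cube R n)); last first.
  move=> A mA _; apply/esym.
  apply: (@product_measure_unique _ _ _ _ _ (unit_leb R) (lebesgue_cube R n)
     (mrestr prd mD)) => // B C mB mC.
  rewrite /= /mrestr -setXI product_measure1E //.
  - by apply: measurableI => //; exact: measurable_itv.
  - by apply: measurableI => //; exact: measurable_cube.
  by rewrite (fubini_tonelli1 (g \o @tcons R n)) //=.
by move=> x; exact: g0.
Qed.

Lemma measurable_set_coord n (i : 'I_n) :
  measurable_fun setT (fun z : Rn R n * measurableTypeR R => set_coord i z.2 z.1).
Proof.
apply/measurable_fun_tnthP => j.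
rewrite (_ : _ \o _ = fun z : Rn R n * measurableTypeR R =>
   if j == i then z.2 else tnth z.1 j); last first.
  by apply/funext => z /=; rewrite tnth_mktuple.
case: (j == i); first exact: measurable_snd.
exact: (measurableT_comp (measurable_tnth j) measurable_fst).
Qed.

Lemma set_coord_tcons0 n (a t : measurableTypeR R) (y : Rn R n) :
  set_coord ord0 t (tcons (a, y)) = tcons (t, y).
Proof.
apply: eq_from_tnth => i; rewrite tnth_mktuple.
by case: (unliftP ord0 i) => [j|] -> //=; rewrite !tnthS.
Qed.

Lemma set_coord_tconsS n (j : 'I_n) (a t : measurableTypeR R) (y : Rn R n) :
  set_coord (lift ord0 j) t (tcons (a, y)) = tcons (a, set_coord j t y).
Proof.
apply: eq_from_tnth => i; rewrite tnth_mktuple.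
by case: (unliftP ord0 i) => [k|] -> //=; rewrite ?tnthS ?tnth_mktuple.
Qed.

Lemma measurable_slice n (i : 'I_n) (g : Rn R n -> \bar R) :
  measurable_fun setT g ->
  measurable_fun setT (fun z : Rn R n * measurableTypeR R => g (set_coord i z.2 z.1)).
Proof. by move=> mg; apply: measurableT_comp => //; exact: measurable_set_coord. Qed.

Lemma measurable_slice_integral n (i : 'I_n) (g : Rn R n -> \bar R) :
  measurable_fun setT g -> (forall x, 0 <= g x) ->
  measurable_fun setT (fun x => \int[unit_leb R]_t g (set_coord i t x)).
Proof.
move=> mg g0.
exact: (measurable_fun_fubini_tonelli_F (m2 := unit_leb R) _ (measurable_slice i mg)).
Qed.

(** Overwriting coordinate i by an independent variable of law [unit_leb] preserves the total
    integral. This plays the role of Fubini for an arbitrary slot without permuting coordinates. The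
    induction peels off the first coordinate until i is that coordinate. *)
Lemma ge0_integral_slice n (i : 'I_n) (g : Rn R n -> \bar R) :
  measurable_fun setT g -> (forall x, 0 <= g x) ->
  \int[lebesgue_cube R n]_x g x =
  \int[lebesgue_cube R n]_x \int[unit_leb R]_t g (set_coord i t x).
Proof.
elim: n i g => [[] //|n IH] i g mg g0.
have mgc : measurable_fun setT (g \o @tcons R n).
  by apply: measurableT_comp => //; exact: measurable_tcons.
rewrite ge0_integral_cubeS // ge0_integral_cubeS; last 2 first.
- exact: measurable_slice_integral.
- by move=> x; exact: integral_ge0.
case: (unliftP ord0 i) => [j|] ->.
  apply: eq_integral => a _.
  under [RHS]eq_integral do under eq_integral do rewrite set_coord_tconsS.
  apply: (IH j (fun y => g (tcons (a, y)))) => //.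
  exact: (measurableT_comp mgc (measurable_pair1 a)).
(* For the first slot the inner integral no longer depends on a, so integrating over a only
   multiplies by the mass 1. *)
pose C := \int[lebesgue_cube R n]_y \int[unit_leb R]_t g (tcons (t, y)).
transitivity C.
  by apply: (fubini_tonelli (g \o @tcons R n)) => // z; exact: g0.
transitivity (\int[unit_leb R]_a (cst C) a).
  transitivity (C * unit_leb R setT); first by rewrite unit_leb_setT mule1.
  by apply/esym; exact: integral_cst.
apply: eq_integral => a _; apply: eq_integral => y _; apply: eq_integral => t _.
by rewrite set_coord_tcons0.
Qed.

End slicing.

(** * Real-valued integrals *)

Section real_integrals.
Context d1 d2 (T1 : measurableType d1) (T2 : measurableType d2) (R : realType).

(** Tonelli gives measurability for the positive and negative parts separately, and [fine] of their
    difference is measurable even where it is a default value. *)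
Lemma measurable_Rintegral (m2 : {sigma_finite_measure set T2 -> \bar R})
    (f : T1 * T2 -> R) : measurable_fun setT f ->
  measurable_fun setT (fun x => \int[m2]_y f (x, y)).
Proof.
move=> mf; have mEf : measurable_fun setT (EFin \o f) by exact/measurable_EFinP.
rewrite /Rintegral; apply: (measurableT_comp (fine_measurable measurableT)).
under eq_fun do rewrite integralE.
apply: emeasurable_funB.
- rewrite (_ : (fun x => _) = fubini_F m2 (EFin \o f)^\+%E); last first.
    by apply/funext => x; apply: eq_integral => y _; rewrite !funeposE.
  exact: (measurable_fun_fubini_tonelli_F _ (measurable_funepos mEf)).
- rewrite (_ : (fun x => _) = fubini_F m2 (EFin \o f)^\-%E); last first.
    by apply/funext => x; apply: eq_integral => y _; rewrite !funenegE.
  exact: (measurable_fun_fubini_tonelli_F _ (measurable_funeneg mEf)).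
Qed.

Lemma integrable_bounded (mu : {finite_measure set T1 -> \bar R}) (f : T1 -> R)
    (C : R) : measurable_fun setT f -> (forall x, `|f x| <= C) ->
  mu.-integrable setT (EFin \o f).
Proof.
move=> mf fC; apply: (le_integrable measurableT _ _
  (finite_measure_integrable_cst mu C measurableT)).
- exact/measurable_EFinP.
- by move=> x _ /=; rewrite lee_fin (le_trans (fC x)) ?ler_norm.
Qed.

Lemma integrable_boundedM (mu : {measure set T1 -> \bar R}) (b f : T1 -> R)
    (C : R) : measurable_fun setT b -> (forall x, `|b x| <= C) ->
  mu.-integrable setT (EFin \o f) ->
  mu.-integrable setT (EFin \o (fun x => b x * f x)).
Proof.
move=> mb bC If; have := integrableZl measurableT C If.
have mf : measurable_fun setT f by exact/measurable_EFinP/(measurable_int mu).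
apply: (le_integrable measurableT).
- by apply/measurable_EFinP; exact: measurable_funM.
- move=> x _ /=; rewrite lee_fin !normrM ler_wpM2r //.
  by rewrite (le_trans (bC x)) // ler_norm.
Qed.

(** Sections are assumed integrable everywhere, not just almost everywhere, so that [fine] loses
    nothing on any inner integral. *)
Lemma Rintegral_Fubini (m1 : {sigma_finite_measure set T1 -> \bar R})
    (m2 : {sigma_finite_measure set T2 -> \bar R}) (f : T1 * T2 -> R) :
  (m1 \x m2)%E.-integrable setT (EFin \o f) ->
  (forall x, m2.-integrable setT (fun y => (f (x, y))%:E)) ->
  (forall y, m1.-integrable setT (fun x => (f (x, y))%:E)) ->
  \int[m1]_x \int[m2]_y f (x, y) = \int[m2]_y \int[m1]_x f (x, y).
Proof.
move=> If I2 I1; rewrite /Rintegral.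
under eq_integral do rewrite fineK ?integrable_fin_num //.
under [in RHS]eq_integral do rewrite fineK ?integrable_fin_num //.
by rewrite (Fubini If).
Qed.

End real_integrals.

(** All exchanges of real integrals in the one-dimensional argument have this shape. The integrand
    is dominated by C |q y|, which is integrable on the product because [m1] has mass 1. *)
Lemma bounded_kernel_Fubini d1 d2 (T1 : measurableType d1)
    (T2 : measurableType d2) (R : realType) (m1 : probability T1 R)
    (m2 : probability T2 R) (b : T1 * T2 -> R) (q : T2 -> R) (C : R) :
  measurable_fun setT b -> (forall z, `|b z| <= C) ->
  m2.-integrable setT (EFin \o q) ->
  \int[m1]_x \int[m2]_y (b (x, y) * q y) =
  \int[m2]_y ((\int[m1]_x b (x, y)) * q y).
Proof.
move=> mb bC Iq.
have mq : measurable_fun setT q by exact/measurable_EFinP/(measurable_int m2).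
have mb1 x : measurable_fun setT (fun y => b (x, y)).
  exact: (measurableT_comp mb (measurable_pair1 x)).
have mb2 y : measurable_fun setT (fun x => b (x, y)).
  exact: (measurableT_comp mb (measurable_pair2 y)).
have Ib y : m1.-integrable setT (EFin \o (fun x => b (x, y))).
  by apply: integrable_bounded => // x; exact: bC.
rewrite (@Rintegral_Fubini _ _ _ _ _ _ _ (fun z => b z * q z.2)) /=.
- by apply: eq_Rintegral => y _; rewrite RintegralZr.
- apply: (integrable_boundedM mb bC).
  apply/integrable21ltyP; first by apply/measurable_EFinP; exact: measurableT_comp.
  have /integrableP[_ qoo] := Iq; apply: le_lt_trans qoo.
  rewrite le_eqVlt; apply/orP; left; apply/eqP.
  by apply: eq_integral => y _ /=; rewrite integral_cst //= probability_setT mule1.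
- by move=> x; apply: integrable_boundedM Iq => // y; exact: bC.
- move=> y; under eq_fun do rewrite mulrC EFinM.
  exact: (integrableZl measurableT (q y) (Ib y)).
Qed.

Lemma ae_imply d (T : measurableType d) (R : realType)
    (mu : {measure set T -> \bar R}) (P Q : T -> Prop) :
  {ae mu, forall x, P x} -> (forall x, P x -> Q x) -> {ae mu, forall x, Q x}.
Proof. by move=> aeP PQ; apply: filterS aeP. Qed.

Section unit_interval.
Variable R : realType.
Notation U := (unit_leb R).

Lemma unit_leb_ae : {ae U, forall x, 0 < x < 1}.
Proof.
pose I : set (measurableTypeR R) := `]0, 1[%classic.
have mI : measurable I by exact: measurable_itv.
exists (~` I); split; first exact: measurableC.
  by rewrite /= /unit_leb /mrestr setICl measure0.
by move=> x; apply: contra_not; rewrite /I /= in_itv.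
Qed.

Lemma le_integral_unit (f g : R -> \bar R) :
  measurable_fun setT f -> measurable_fun setT g ->
  (forall x, 0 <= f x)%E -> (forall x, 0 <= g x)%E ->
  (forall x, 0 < x < 1 -> (f x <= g x)%E) ->
  (\int[U]_x f x <= \int[U]_x g x)%E.
Proof.
move=> mf mg f0 g0 fg; apply: ae_ge0_le_integral => //.
by apply: (ae_imply unit_leb_ae) => x x01 _; rewrite fg.
Qed.

End unit_interval.

(** * The one-dimensional inequality *)

Section sine_integral.
Variable R : realType.
Implicit Types s t : R.

Lemma integral_C1 (F f : R -> R) (a b : R) : a < b ->
  (forall x : R, is_derive x 1 F (f x)) -> continuous f ->
  (\int[lebesgue_measure]_(x in `[a, b]) (f x)%:E = (F b - F a)%:E)%E.
Proof.
move=> ab dF cf; rewrite (@continuous_FTC2 _ f F) //.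
- exact: continuous_subspaceT.
- have cF x : {for x, continuous F}.
    by apply: differentiable_continuous; apply/derivable1_diffP; exact: ex_derive.
  split; first by move=> x _; exact: ex_derive.
  + by apply: cvg_at_right_filter; exact: cF.
  + by apply: cvg_at_left_filter; exact: cF.
- by move=> x _; rewrite derive1E; exact: derive_val.
Qed.

Lemma is_derive_sin_pi (x : R) :
  is_derive x 1 (fun t => sin (pi * t)) (pi * cos (pi * x)).
Proof.
by apply: is_derive_eq; rewrite /GRing.scale /= mulr1 mulrC.
Qed.

Lemma is_derive_cos_pi (x : R) :
  is_derive x 1 (fun t => cos (pi * t)) (- (pi * sin (pi * x))).
Proof. by apply: is_derive_eq; rewrite /GRing.scale /= mulr1 mulNr mulrC. Qed.

Lemma green_sin (s : R) : 0 < s < 1 ->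
  (\int[lebesgue_measure]_(t in `]0%R, 1%R[)
     ((if t <= s then t * (1 - s) else s * (1 - t))%R * sin (pi * t))%:E =
   (pi^-2 * sin (pi * s))%:E)%E.
Proof.
move=> /andP[s0 s1].
have pi0 : (pi : R) != 0 by rewrite gt_eqF ?pi_gt0.
have cs : continuous (fun t : R => sin (pi * t)).
  by move=> x; apply: differentiable_continuous; apply/derivable1_diffP;
    exact: (@ex_derive _ _ _ _ _ _ _ (is_derive_sin_pi x)).
pose g1 t : R := t * (1 - s) * sin (pi * t).
pose g2 t : R := s * (1 - t) * sin (pi * t).
(* Antiderivatives of [g1] and [g2], from one integration by parts. In G1 s - G1 0 + G2 1 - G2 s the
   cosines cancel and the sines add up to pi^-2 sin (pi s). *)
pose G1 t : R := (1 - s) * (pi^-2 * sin (pi * t) - pi^-1 * (t * cos (pi * t))).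
pose G2 t : R := s * (- (pi^-1 * ((1 - t) * cos (pi * t))) - pi^-2 * sin (pi * t)).
have dG1 (x : R) : is_derive x 1 G1 (g1 x).
  have h1 := is_derive_sin_pi x; have h2 := is_derive_cos_pi x.
  apply: is_derive_eq; rewrite /GRing.scale /= /g1.
  by move: (sin _) (cos _) => S C; move: (@pi R) pi0 => p p0; field.
have dG2 (x : R) : is_derive x 1 G2 (g2 x).
  have h1 := is_derive_sin_pi x; have h2 := is_derive_cos_pi x.
  apply: is_derive_eq; rewrite /GRing.scale /= /g2.
  by move: (sin _) (cos _) => S C; move: (@pi R) pi0 => p p0; field.
have cg1 : continuous g1.
  move=> x; apply: cvgM; last exact: cs.
  by apply: cvgM; [exact: cvg_id | exact: cvg_cst].
have cg2 : continuous g2.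
  move=> x; apply: cvgM; last exact: cs.
  apply: cvgM; first exact: cvg_cst.
  by apply: cvgB; [exact: cvg_cst | exact: cvg_id].
pose g t : R := (if t <= s then t * (1 - s) else s * (1 - t)) * sin (pi * t).
have mg : measurable_fun setT g.
  apply: measurable_funM; last exact: continuous_measurable_fun.
  apply: measurable_fun_ifT.
  - exact: measurable_fun_ler.
  - exact: measurable_funM.
  - by apply: measurable_funM => //; exact: measurable_funB.
have mEg D : measurable_fun D (EFin \o g).
  by apply: measurable_funTS; exact/measurable_EFinP.
transitivity (\int[lebesgue_measure]_(t in `[0%R, 1%R]) (g t)%:E)%E.
  by rewrite -(@integral_itv_bndoo _ 0 1 _ true false).
rewrite (@itv_bndbnd_setU _ _ (BLeft 0) (BRight s)) ?bnd_simp ?ltW //.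
rewrite integral_setU_EFin //=; last 2 first.
- exact: measurable_funTS.
- apply/disj_setPS => x /= []; rewrite !in_itv /= => /andP[_ xs] /andP[sx _].
  by move: (lt_le_trans sx xs); rewrite ltxx.
rewrite (integral_itv_obnd_cbnd (mEg _)).
transitivity (\int[lebesgue_measure]_(x in `[0%R, s]) (g1 x)%:E +
  \int[lebesgue_measure]_(x in `[s, 1%R]) (g2 x)%:E)%E.
  congr (_ + _)%E; apply: eq_integral => x.
    by rewrite inE /= in_itv /= => /andP[_ xs]; rewrite /g xs.
  rewrite inE /= in_itv /= => /andP[sx _].
  rewrite /g /g2 /=; case: ifP => // xs.
  by have -> : x = s by apply/eqP; rewrite eq_le sx xs.
rewrite (integral_C1 s0 dG1 cg1) (integral_C1 s1 dG2 cg2) -EFinD.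
congr EFin; rewrite /G1 /G2 !mulr0 mulr1 sin0 sinpi cos0.
rewrite !mulr0.
move: (sin _) (cos _) => S C; move: (@pi R) pi0 => p p0; field.
exact: p0.
Qed.

End sine_integral.

(** * The Dirichlet Green kernel and its sine eigenfunction *)

Section green_kernel.
Variable R : realType.
Notation U := (unit_leb R).
Implicit Types s t x : R.

(** Turns an integral with a moving endpoint into one of a bounded kernel against the fixed measure
    [unit_leb], ready for Fubini. *)
Definition step t x : R := (t < x)%R%:R.

Lemma step_bounded t x : `|step t x| <= 1.
Proof. by rewrite /step; case: (t < x); rewrite ?normr1 ?normr0. Qed.

Lemma measurable_step d (T : measurableType d) (f g : T -> R) :
  measurable_fun setT f -> measurable_fun setT g ->
  measurable_fun setT (fun z => step (f z) (g z)).
Proof.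
move=> mf mg; rewrite (_ : (fun z => _) = fun z => if f z < g z then 1 else 0).
  by apply: measurable_fun_ifT => //; exact: measurable_fun_ltr.
by apply/funext => z; rewrite /step; case: ifP.
Qed.

(** This is 1 - s on [0, 1]. As an integral it stays in [0, 1] for every real s, so [green] is
    bounded and nonnegative on the whole plane. *)
Definition tail s : R := \int[U]_x step s x.

Lemma step_integrable s : U.-integrable setT (EFin \o step s).
Proof.
apply: (@integrable_bounded _ _ _ U (step s) 1) => [|x].
- exact: measurable_step.
- exact: step_bounded.
Qed.

Lemma measurable_tail : measurable_fun setT tail.
Proof.
apply: (@measurable_Rintegral _ _ _ _ _ U (fun z => step z.1 z.2)).
exact: measurable_step.
Qed.

Lemma Rintegral_unit_cst (c : R) : \int[U]_x c = c.
Proof.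
transitivity (c * fine (U setT)); first exact: Rintegral_cst.
by rewrite unit_leb_setT mulr1.
Qed.

Lemma tail_ge0 s : 0 <= tail s.
Proof. by apply: Rintegral_ge0 => x _; rewrite /step ler0n. Qed.

Lemma tail_le1 s : tail s <= 1.
Proof.
have -> : 1 = \int[U]_x (1 : R).
  by rewrite Rintegral_unit_cst.
apply: le_Rintegral => //.
- exact: step_integrable.
- exact: (finite_measure_integrable_cst U 1).
- by move=> x _; rewrite /step lern1; case: (s < x).
Qed.

Lemma tailE s : 0 <= s <= 1 -> tail s = 1 - s.
Proof.
move=> /andP[s0 s1]; rewrite /tail /Rintegral.
have mI : measurable (`]s, +oo[%classic : set (measurableTypeR R)).
  exact: measurable_itv.
rewrite (_ : (fun x => (step s x)%:E) =
  (fun x => (\1_(`]s, +oo[%classic : set (measurableTypeR R)) x)%:E)); last first.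
  apply/funext => x; rewrite indicE /step; congr (_%:R%:E).
  by apply/esym; case: (ltP s x) => h; [rewrite mem_set|rewrite memNset] => //=;
   rewrite in_itv /= andbT; [|rewrite ltNge h].
rewrite integral_indic // setIT /= /unit_leb /mrestr.
rewrite (_ : _ `&` _ = `]s, 1[%classic); last first.
  apply/seteqP; split => x /=; rewrite !in_itv /= andbT.
    by move=> [-> /andP[]].
  by move=> /andP[sx ->]; rewrite sx (le_lt_trans s0 sx).
rewrite lebesgue_measure_itv /= lte_fin; case: ltP => [//|].
by move=> h; rewrite (le_anti (introT andP (conj s1 h))) subrr.
Qed.

(** Source of the maximum in [green]: the product of two steps integrates to [tail (Num.max s t)],
    and (1 - max) - (1 - s)(1 - t) = min - s t. *)
Lemma step_mul s t x : step s x * step t x = step (Num.max s t) x.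
Proof. by rewrite /step gt_max -natrM mulnb. Qed.

(* The Green function of -u'' on (0, 1) with Dirichlet conditions. *)
Definition green s t : R := tail (Num.max s t) - tail s * tail t.

Lemma greenC s t : green s t = green t s.
Proof. by rewrite /green maxC mulrC. Qed.

Lemma green_ge0 s t : 0 <= green s t.
Proof.
wlog st : s t / s <= t.
  by move=> H; case: (leP s t) => [/H //|/ltW /H]; rewrite greenC.
rewrite /green (max_idPr st) subr_ge0 ler_piMl ?tail_ge0 ?tail_le1 //.
Qed.

Lemma green_le1 s t : green s t <= 1.
Proof.
by rewrite /green lerBlDr (le_trans (tail_le1 _)) // lerDl mulr_ge0 // tail_ge0.
Qed.

Lemma measurable_green d (T : measurableType d) (f g : T -> R) :
  measurable_fun setT f -> measurable_fun setT g ->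
  measurable_fun setT (fun z => green (f z) (g z)).
Proof.
move=> mf mg; apply: measurable_funB.
  by apply: (measurableT_comp measurable_tail); exact: measurable_maxr.
by apply: measurable_funM; exact: (measurableT_comp measurable_tail).
Qed.

Lemma greenE s t : 0 < s < 1 -> 0 < t < 1 ->
  green s t = if t <= s then t * (1 - s) else s * (1 - t).
Proof.
move=> /andP[s0 s1] /andP[t0 t1].
have s01 : 0 <= s <= 1 by rewrite !ltW.
have t01 : 0 <= t <= 1 by rewrite !ltW.
rewrite /green (tailE s01) (tailE t01) tailE; last by rewrite maxEle; case: ifP.
by rewrite maxElt; case: ltP => h; ring.
Qed.

(* The value 1 off (0, 1) makes the Schur weight positive everywhere. *)
Definition sine t : R := if 0 < t < 1 then sin (pi * t) else 1.

Lemma sine_gt0 t : 0 < sine t.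
Proof.
rewrite /sine; case: ifP => // /andP[t0 t1]; apply: sin_gt0_pi.
by rewrite mulr_gt0 ?pi_gt0 //= gtr_pMr ?pi_gt0.
Qed.

Lemma measurable_sine : measurable_fun setT sine.
Proof.
apply: measurable_fun_ifT => //.
- by apply: measurable_and; exact: measurable_fun_ltr.
- apply: continuous_measurable_fun => x.
  apply: differentiable_continuous; apply/derivable1_diffP.
  exact: (@ex_derive _ _ _ _ _ _ _ (is_derive_sin_pi x)).
Qed.

Lemma integral_green_sine s : 0 < s < 1 ->
  (\int[U]_t (green s t * sine t)%:E = (pi^-2 * sine s)%:E)%E.
Proof.
move=> s01; rewrite /sine s01 -green_sin //.
rewrite -unit_integralE; last first.
  apply/measurable_EFinP; apply: measurable_funM; last exact: measurable_sine.
  by apply: measurable_green.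
apply: eq_integral => t; rewrite inE /= in_itv /= => t01.
by rewrite t01 greenE.
Qed.

End green_kernel.

(** * The Schur test *)

Section schur_test.
Variable R : realType.
Notation U := (unit_leb R).
Implicit Types (q : R -> R) (s t x c : R).

Lemma sqr_integrable q : measurable_fun setT q ->
  (\int[U]_x (q x ^+ 2)%:E < +oo)%E ->
  U.-integrable setT (EFin \o (fun x => q x ^+ 2)).
Proof.
move=> mq qoo; apply/integrableP; split.
  by apply/measurable_EFinP; exact: measurable_funX.
by under eq_integral do rewrite /= ger0_norm ?sqr_ge0 //.
Qed.

(** By |q| <= 1 + q^2 and the finite mass. *)
Lemma L2_integrable q : measurable_fun setT q ->
  (\int[U]_x (q x ^+ 2)%:E < +oo)%E -> U.-integrable setT (EFin \o q).
Proof.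
move=> mq qoo; have Iq2 := sqr_integrable mq qoo.
have I1 := finite_measure_integrable_cst U 1 (@measurableT _ (measurableTypeR R)).
apply: (le_integrable measurableT _ _ (integrableD measurableT I1 Iq2)).
  exact/measurable_EFinP.
move=> x _ /=; rewrite lee_fin ler_norml.
have := sqr_ge0 (q x); have := sqr_ge0 (q x - 1); have := sqr_ge0 (q x + 1).
move=> h1 h2 h3; rewrite [`|1 + _|]ger0_norm ?addr_ge0 //.
by apply/andP; split; nra.
Qed.

Lemma amgm (a b r : R) : 0 < r -> a * b <= (r * a ^+ 2 + r^-1 * b ^+ 2) / 2.
Proof.
move=> r0; rewrite -subr_ge0.
have -> : (r * a ^+ 2 + r^-1 * b ^+ 2) / 2 - a * b = (r * a - b) ^+ 2 / (2 * r).
  by field; rewrite lt0r_neq0.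
by rewrite divr_ge0 ?sqr_ge0 // mulr_ge0 // ltW.
Qed.

(* Schur test for the Green kernel, with the weight sin (pi t). *)
Lemma green_schur q : measurable_fun setT q ->
  (\int[U]_t \int[U]_s (green s t * (`|q s| * `|q t|))%:E <=
   (pi^-2)%:E * \int[U]_t (q t ^+ 2)%:E)%E.
Proof.
move=> mq.
(* Half of [amgm] with r = sine t / sine s: the kernel form is at most [G (s, t) + G (t, s)]. The
   weight is placed so that integrating over t meets the eigenvalue equation and leaves pi^-2 / 2
   times q s ^+ 2. *)
pose G (z : measurableTypeR R * measurableTypeR R) : R :=
  green z.1 z.2 * (sine z.2 / sine z.1 * q z.1 ^+ 2) / 2.
have w0 t : 0 <= sine t by rewrite ltW // sine_gt0.
have G0 z : 0 <= G z by rewrite /G !(sqr_ge0, invr_ge0, w0, green_ge0, ler0n, mulr_ge0).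
have mG : measurable_fun setT G.
  apply: measurable_funM => //; apply: measurable_funM.
    exact: (measurable_green measurable_fst measurable_snd).
  apply: measurable_funM.
    apply: measurable_funM; first exact: (measurableT_comp (@measurable_sine R)).
    under eq_fun do rewrite -(powR_inv1 (w0 _)).
    apply: (measurableT_comp (measurable_powR _)).
    exact: (measurableT_comp (@measurable_sine R)).
  by apply: measurable_funX; exact: measurableT_comp.
have mEG : measurable_fun setT (EFin \o G) by exact/measurable_EFinP.
have mG1 t : measurable_fun setT (fun s => (G (s, t))%:E).
  exact: (measurableT_comp mEG (measurable_pair2 t)).
have mG2 t : measurable_fun setT (fun s => (G (t, s))%:E).
  exact: (measurableT_comp mEG (measurable_pair1 t)).
have mq2 : measurable_fun setT (fun t => (q t ^+ 2)%:E).
  by apply/measurable_EFinP; exact: measurable_funX.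
have GE s : 0 < s < 1 ->
    (\int[U]_t (G (s, t))%:E = (pi^-2 / 2)%:E * (q s ^+ 2)%:E)%E.
  move=> s01.
  transitivity (\int[U]_t ((q s ^+ 2 / sine s / 2)%:E * (green s t * sine t)%:E))%E.
    by apply: eq_integral => t _; rewrite -EFinM /G /=; congr EFin; ring.
  rewrite ge0_integralZl_EFin //.
  - rewrite integral_green_sine // -!EFinM; congr EFin.
    have /lt0r_neq0 ws := sine_gt0 s; have /lt0r_neq0 := pi_gt0 R.
    by move: (@pi R) (sine s) ws => p w ws p0; field; rewrite p0.
  - by move=> t _; rewrite lee_fin mulr_ge0 ?green_ge0 //.
  - apply/measurable_EFinP; apply: measurable_funM; last exact: measurable_sine.
    exact: measurable_green.
  - by rewrite !(sqr_ge0, invr_ge0, w0, ler0n, mulr_ge0).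
pose A (z : measurableTypeR R * measurableTypeR R) : R :=
  green z.1 z.2 * (`|q z.1| * `|q z.2|).
have mA : measurable_fun setT (EFin \o A).
  apply/measurable_EFinP; apply: measurable_funM.
    exact: (measurable_green measurable_fst measurable_snd).
  by apply: measurable_funM; apply: measurableT_comp => //; exact: measurableT_comp.
have A0 z : 0 <= A z by rewrite /A !(normr_ge0, green_ge0, mulr_ge0).
have AG s t : A (s, t) <= G (s, t) + G (t, s).
  rewrite /A /G /= [green t s]greenC -!mulrA -mulrDr ler_wpM2l ?green_ge0 //.
  have ws := sine_gt0 s; have wt := sine_gt0 t.
  have := @amgm `|q s| `|q t| (sine t / sine s) (divr_gt0 wt ws).
  by rewrite invf_div !real_normK ?num_real // !mulrA mulrDl.
change (\int[U]_t \int[U]_s (A (s, t))%:E <=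
  (pi^-2)%:E * \int[U]_t (q t ^+ 2)%:E)%E.
have k0 : 0 <= (pi : R)^-2 / 2 by rewrite divr_ge0 // invr_ge0 sqr_ge0.
have -> : (pi : R)^-2 = pi^-2 / 2 + pi^-2 / 2 by rewrite -splitr.
move: (pi^-2 / 2) k0 GE => k k0 GE.
clearbody A G; clear w0.
(* The known integral of [G] is the one over its second argument. Tonelli brings the first half to
   that order; the second half has it after renaming. *)
have tonelli : (\int[U]_t \int[U]_s (G (s, t))%:E = \int[U]_s \int[U]_t (G (s, t))%:E)%E.
  by rewrite (fubini_tonelli (EFin \o G)).
have half : (\int[U]_s \int[U]_t (G (s, t))%:E <=
    k%:E * \int[U]_t (q t ^+ 2)%:E)%E.
  rewrite -ge0_integralZl_EFin //; last by move=> t _; rewrite lee_fin sqr_ge0.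
  apply: le_integral_unit.
  - exact: (measurable_fun_fubini_tonelli_F (m2 := U) (EFin \o G)).
  - exact: measurable_funeM.
  - by move=> x; apply: integral_ge0 => t _; rewrite lee_fin G0.
  - by move=> x; rewrite -EFinM lee_fin mulr_ge0 ?sqr_ge0.
  - by move=> x x01; rewrite GE.
apply: (@le_trans _ _
  (\int[U]_t (\int[U]_s (G (s, t))%:E + \int[U]_s (G (t, s))%:E))%E).
  apply: ge0_le_integral => //.
  - by move=> t _; apply: integral_ge0 => s _; rewrite lee_fin (A0 (s, t)).
  - exact: (measurable_fun_fubini_tonelli_G (m1 := U) (EFin \o A)).
  - apply: emeasurable_funD.
    + exact: (measurable_fun_fubini_tonelli_G (m1 := U) (EFin \o G)).
    + exact: (measurable_fun_fubini_tonelli_F (m2 := U) (EFin \o G)).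
  - move=> t _; rewrite -ge0_integralD; [|by []|by move=> s _; rewrite lee_fin|exact: mG1
      |by move=> s _; rewrite lee_fin|exact: mG2].
    apply: ge0_le_integral => //.
    + by move=> s _; rewrite lee_fin (A0 (s, t)).
    + exact: (measurableT_comp mA (measurable_pair2 t)).
    + exact: (emeasurable_funD (mG1 t) (mG2 t)).
    + by move=> s _; rewrite -EFinD lee_fin; exact: AG.
rewrite ge0_integralD //; last 4 first.
- by move=> t _; apply: integral_ge0 => s _; rewrite lee_fin.
- exact: (measurable_fun_fubini_tonelli_G (m1 := U) (EFin \o G)).
- by move=> t _; apply: integral_ge0 => s _; rewrite lee_fin.
- exact: (measurable_fun_fubini_tonelli_F (m2 := U) (EFin \o G)).
rewrite tonelli; apply: le_trans (leeD half half) _.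
by rewrite -ge0_muleDl ?lee_fin // -EFinD.
Qed.

End schur_test.

(** * The squared norm of the centred primitive as a Green form *)

Section primitive.
Variable R : realType.
Notation U := (unit_leb R).
Implicit Types (q : R -> R) (s t x c : R).

Definition running q x : R := \int[U]_t (step t x * q t).

Lemma measurable_running q : measurable_fun setT q ->
  measurable_fun setT (running q).
Proof.
move=> mq; apply: (@measurable_Rintegral _ _ _ _ _ U (fun z => step z.2 z.1 * q z.2)).
apply: measurable_funM; last exact: measurableT_comp.
exact: (measurable_step measurable_snd measurable_fst).
Qed.

Lemma running_integrable q x : U.-integrable setT (EFin \o q) ->
  U.-integrable setT (EFin \o (fun t => step t x * q t)).
Proof.
move=> Iq; apply: (@integrable_boundedM _ _ _ U (fun t => step t x) q 1) => [|t|//].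
- exact: measurable_step.
- exact: step_bounded.
Qed.

Lemma running_bounded q : U.-integrable setT (EFin \o q) ->
  forall x, `|running q x| <= \int[U]_t `|q t|.
Proof.
move=> Iq x; have Ix := running_integrable x Iq.
apply: (le_trans (le_normr_Rintegral measurableT Ix)).
apply: le_Rintegral => //.
- exact: (integrable_norm Ix).
- exact: (integrable_norm Iq).
- move=> t _; rewrite normrM -[leRHS]mul1r ler_wpM2r //; exact: step_bounded.
Qed.

Lemma Rintegral_itv0x q x : measurable_fun setT q -> x <= 1 ->
  \int[lebesgue_measure]_(t in `]0, x[) q t = running q x.
Proof.
move=> mq x1; rewrite /running /Rintegral; congr fine.
have mI : measurable (`]0, x[%classic : set (measurableTypeR R)).
  exact: measurable_itv.
rewrite -unit_integralE; last first.
  apply/measurable_EFinP; apply: measurable_funM => //.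
  exact: measurable_step.
rewrite integral_mkcond [RHS]integral_mkcond; apply: eq_integral => t _.
rewrite /patch /step; case: ifP => h1; case: ifP => h2 //.
- by move: h1; rewrite inE /= in_itv /= => /andP[_ ->]; rewrite mul1r.
- move: h1 h2; rewrite inE /= in_itv /= => /andP[t0 tx].
  by rewrite mem_set //= in_itv /= t0 (lt_le_trans tx x1).
- move: h1 h2; rewrite [X in _ -> X -> _]inE /= in_itv /= => + /andP[t0 t1].
  by case: ltP => tx; rewrite ?mul0r // mem_set //= in_itv /= t0 tx.
Qed.

Lemma Rintegral_unitE q : measurable_fun setT q ->
  \int[lebesgue_measure]_(t in `]0, 1[) q t = \int[U]_t q t.
Proof. by move=> mq; rewrite /Rintegral unit_integralE //; exact/measurable_EFinP. Qed.

Lemma primitiveE q x : measurable_fun setT q -> 0 < x < 1 ->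
  primitive q x = running q x - \int[U]_y running q y.
Proof.
move=> mq /andP[x0 x1]; rewrite /primitive Rintegral_itv0x ?(ltW x1) //.
congr (_ - _); rewrite -Rintegral_unitE; last exact: measurable_running.
apply: eq_Rintegral => y; rewrite inE /= in_itv /= => /andP[_ y1].
by rewrite Rintegral_itv0x // ltW.
Qed.

Section L2.
Variable q : R -> R.
Hypothesis mq : measurable_fun setT q.
Hypothesis Iq : U.-integrable setT (EFin \o q).

Let F := running q.
Let m : R := \int[U]_y F y.
Let f x : R := F x - m.
(** The adjoint of A applied to f = A q; integration over (t, 1) is the adjoint of [running], and f
    is already centred. *)
Let phi t : R := \int[U]_x (step t x * f x).

Let mF : measurable_fun setT F. Proof. exact: measurable_running. Qed.
Let mf : measurable_fun setT f. Proof. exact: measurable_funB. Qed.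

Let IF : U.-integrable setT (EFin \o F).
Proof. by apply: (@integrable_bounded _ _ _ U F _ mF) => x; exact: running_bounded. Qed.

Let f_bounded : exists C : R, forall x, `|f x| <= C.
Proof.
exists (\int[U]_t `|q t| + `|m|) => x.
by rewrite (le_trans (ler_normB _ _)) // lerD2r; exact: running_bounded.
Qed.

Let If : U.-integrable setT (EFin \o f).
Proof. by have [C fC] := f_bounded; exact: (@integrable_bounded _ _ _ U f C). Qed.

Let int_f : \int[U]_x f x = 0.
Proof.
rewrite RintegralB //; last exact: (finite_measure_integrable_cst U m).
by rewrite Rintegral_unit_cst subrr.
Qed.

Let mE : m = \int[U]_t (tail t * q t).
Proof.
rewrite /m /F /running.
apply: (@bounded_kernel_Fubini _ _ _ _ _ U U (fun z => step z.2 z.1) q 1 _ _ Iq).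
  exact: (measurable_step measurable_snd measurable_fst).
by move=> z; exact: step_bounded.
Qed.

Let step_int g t : U.-integrable setT (EFin \o g) ->
  U.-integrable setT (EFin \o (fun x => step t x * g x)).
Proof.
move=> Ig; apply: (@integrable_boundedM _ _ _ U (step t) g 1) => [|x|//].
- exact: measurable_step.
- exact: step_bounded.
Qed.

(** Split f into F and m. Fubini and [step_mul] give the kernel [tail (Num.max s t)] for F, and [mE]
    gives [tail s * tail t] for m. *)
Let phiE t : phi t = \int[U]_s (green s t * q s).
Proof.
rewrite /phi /f; under eq_Rintegral do rewrite mulrBr.
rewrite RintegralB //; last 2 first.
- exact: step_int.
- by apply: step_int; exact: (finite_measure_integrable_cst U m).
have -> : \int[U]_x (step t x * m) = tail t * m.
  exact: (RintegralZr m measurableT (step_integrable t)).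
have -> : \int[U]_x (step t x * F x) = \int[U]_s (tail (Num.max s t) * q s).
  transitivity (\int[U]_x \int[U]_s (step (Num.max s t) x * q s)).
    apply: eq_Rintegral => x _.
    rewrite -(RintegralZl _ measurableT (running_integrable x Iq)).
    by apply: eq_Rintegral => s _; rewrite -step_mul; ring.
  apply: (@bounded_kernel_Fubini _ _ _ _ _ U U
    (fun z => step (Num.max z.2 t) z.1) q 1 _ _ Iq).
    apply: measurable_step => //.
    by apply: measurable_maxr => //; exact: measurable_snd.
  by move=> z; exact: step_bounded.
have Itail (g : R -> R) : measurable_fun setT g ->
    U.-integrable setT (EFin \o (fun s => tail (g s) * q s)).
  move=> mg; apply: (@integrable_boundedM _ _ _ U (fun s => tail (g s)) q 1) => //.
    exact: (measurableT_comp (@measurable_tail R)).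
  by move=> s; rewrite ger0_norm ?tail_le1 ?tail_ge0.
have I1 := Itail _ (@measurable_id _ _ setT).
rewrite mE -(RintegralZl _ measurableT I1) -RintegralB //; last 2 first.
- by apply: Itail; exact: measurable_maxr.
- exact: (integrableZl measurableT _ I1).
by apply: eq_Rintegral => s _; rewrite /green; ring.
Qed.

(** As f has mean zero, the integral of f^2 equals that of F f. Expanding F and exchanging the
    integrals moves the step onto f, which produces [phi]. *)
Lemma sqr_centered_running :
  \int[U]_x ((running q x - \int[U]_y running q y) ^+ 2) =
  \int[U]_t ((\int[U]_s (green s t * q s)) * q t).
Proof.
transitivity (\int[U]_t (phi t * q t)); last first.
  by apply: eq_Rintegral => t _; rewrite phiE.
rewrite -/F -/m.
have [C fC] := f_bounded.
have If2 : U.-integrable setT (EFin \o (fun x => f x * f x)).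
  exact: (@integrable_boundedM _ _ _ U f f C).
have IFf : U.-integrable setT (EFin \o (fun x => F x * f x)).
  by apply: (@integrable_boundedM _ _ _ U F f _ mF (running_bounded Iq)).
transitivity (\int[U]_x (F x * f x));
  first change (\int[U]_x (f x ^+ 2) = \int[U]_x (F x * f x)).
  rewrite -[RHS]subr0 -(mulr0 m) -int_f -(RintegralZl _ measurableT If).
  rewrite -RintegralB //; last exact: (integrableZl measurableT m If).
  by apply: eq_Rintegral => x _; rewrite /f; ring.
transitivity (\int[U]_x \int[U]_t (step t x * f x * q t)).
  apply: eq_Rintegral => x _; rewrite mulrC.
  rewrite -(RintegralZl _ measurableT (running_integrable x Iq)).
  by apply: eq_Rintegral => t _; ring.
apply: (@bounded_kernel_Fubini _ _ _ _ _ U U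
  (fun z => step z.2 z.1 * f z.1) q C _ _ Iq).
  apply: measurable_funM; last exact: measurableT_comp.
  exact: (measurable_step measurable_snd measurable_fst).
move=> z; rewrite normrM; apply: le_trans (fC z.1).
by rewrite -[leRHS]mul1r ler_wpM2r //; exact: step_bounded.
Qed.

End L2.
End primitive.

(** Measurability is needed on the whole space, where [primitive] need not agree with its kernel
    form. So the moving endpoint is treated directly, extending the integrand by zero. *)
Lemma measurable_Rintegral_itv0 d (T : measurableType d) (R : realType)
    (h : T * measurableTypeR R -> R) (b : T -> R) :
  measurable_fun setT h -> measurable_fun setT b ->
  measurable_fun setT
    (fun x => \int[lebesgue_measure]_(t in `]0, b x[) h (x, t)).
Proof.
move=> mh mb; under eq_fun do rewrite Rintegral_mkcond.
apply: (@measurable_Rintegral _ _ _ _ _ lebesgue_measure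
  (fun z => ((fun t => h (z.1, t)) \_ `]0, b z.1[) z.2)).
rewrite (_ : (fun z => _) = fun z => if (0 < z.2) && (z.2 < b z.1) then h z else 0).
  apply: measurable_fun_ifT => //.
  apply: measurable_and; apply: measurable_fun_ltr => //.
  exact: (measurableT_comp mb measurable_fst).
apply/funext => -[x t]; rewrite /patch /=.
case: ifPn => [|/negP]; rewrite inE /= in_itv /=; first by move->.
by move/negP/negPf->.
Qed.

Lemma measurable_primitive d (T : measurableType d) (R : realType)
    (h : T * measurableTypeR R -> R) (b : T -> R) :
  measurable_fun setT h -> measurable_fun setT b ->
  measurable_fun setT (fun x => primitive (fun t => h (x, t)) (b x)).
Proof.
move=> mh mb; apply: measurable_funB; first exact: measurable_Rintegral_itv0.
apply: (@measurable_Rintegral_itv0 _ _ _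
  (fun z => \int[lebesgue_measure]_(t in `]0, z.2[) h (z.1, t)) (cst 1)) => //.
apply: (@measurable_Rintegral_itv0 _ (T * measurableTypeR R)%type _
  (fun w => h (w.1.1, w.2)) snd) => //.
apply: (measurableT_comp mh); apply: measurable_fun_pair => //.
exact: (measurableT_comp measurable_fst measurable_fst).
Qed.

(** * Bounds for the average and the primitive on a line *)

Section unit_L2.
Variable R : realType.
Notation U := (unit_leb R).
Implicit Types (q : R -> R) (s t x c : R).

Lemma measurable_primitive1 q : measurable_fun setT q ->
  measurable_fun setT (primitive q).
Proof.
move=> mq;
apply: (@measurable_primitive _ (measurableTypeR R) R (fun z => q z.2) id) => //.
exact: measurableT_comp.
Qed.

Lemma Rintegral_shift_sqr (g : R -> R) c : U.-integrable setT (EFin \o g) ->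
  U.-integrable setT (EFin \o (fun x => g x ^+ 2)) ->
  \int[U]_x ((g x + c) ^+ 2) =
  \int[U]_x (g x ^+ 2) + 2 * c * \int[U]_x g x + c ^+ 2.
Proof.
move=> Ig Ig2; have Ic := finite_measure_integrable_cst U (c ^+ 2) measurableT.
have I2 := integrableZl measurableT (2 * c) Ig.
rewrite -(Rintegral_unit_cst (c ^+ 2)) -(RintegralZl _ measurableT Ig).
rewrite -RintegralD // -RintegralD //; last exact: (integrableD measurableT Ig2 I2).
by apply: eq_Rintegral => x _; ring.
Qed.

Lemma EFin_Rintegral (g : R -> R) : U.-integrable setT (EFin \o g) ->
  (\int[U]_x (g x)%:E = (\int[U]_x g x)%:E)%E.
Proof. by move=> Ig; rewrite fineK //; exact: integrable_fin_num. Qed.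

(** The variance of q is nonnegative; an infinite right-hand side is a separate, trivial case. *)
Lemma sqr_average_le q : measurable_fun setT q ->
  (((\int[lebesgue_measure]_(t in `]0, 1[) q t) ^+ 2)%R%:E <=
   \int[U]_t (q t ^+ 2)%:E)%E.
Proof.
move=> mq; rewrite Rintegral_unitE //.
have [|qoo] := leP +oo%E (\int[U]_t (q t ^+ 2)%:E)%E.
  by rewrite leye_eq => /eqP ->; rewrite leey.
have Iq := L2_integrable mq qoo; have Iq2 := sqr_integrable mq qoo.
rewrite (EFin_Rintegral Iq2) lee_fin.
have := Rintegral_shift_sqr (- \int[U]_t q t) Iq Iq2.
have : 0 <= \int[U]_x ((q x - \int[U]_t q t) ^+ 2).
  by apply: Rintegral_ge0 => x _; exact: sqr_ge0.
set a := \int[U]_t q t; set b := \int[U]_t _; set e := \int[U]_t _.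
by move=> h1 h2; nra.
Qed.

(** Bridge from the signed real form to the nonnegative extended one in [green_schur]. The kernel is
    nonnegative, so absolute values fall on q alone. *)
Lemma green_form_le q : measurable_fun setT q -> U.-integrable setT (EFin \o q) ->
  ((\int[U]_t ((\int[U]_s (green s t * q s)) * q t))%:E <=
   \int[U]_t \int[U]_s (green s t * (`|q s| * `|q t|))%:E)%E.
Proof.
move=> mq Iq.
pose psi t := \int[U]_s (green s t * q s).
have mgreen t : measurable_fun setT (fun s => green s t).
  exact: (@measurable_green R _ (measurableTypeR R) id (cst t)).
have green_norm s t : `|green s t| <= 1 by rewrite ger0_norm ?green_le1 ?green_ge0.
have Igq t : U.-integrable setT (EFin \o (fun s => green s t * q s)).
  apply: (@integrable_boundedM _ _ _ U (fun s => green s t) q 1) => [|s|//].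
    exact: mgreen.
  exact: green_norm.
have mpsi : measurable_fun setT psi.
  apply: (@measurable_Rintegral _ _ _ _ _ U (fun z => green z.2 z.1 * q z.2)).
  apply: measurable_funM; last exact: measurableT_comp.
  exact: (measurable_green measurable_snd measurable_fst).
have psi_norm t : `|psi t| <= \int[U]_s `|q s|.
  apply: (le_trans (le_normr_Rintegral measurableT (Igq t))).
  apply: le_Rintegral => //.
  - exact: (integrable_norm (Igq t)).
  - exact: (integrable_norm Iq).
  - by move=> s _; rewrite normrM -[leRHS]mul1r ler_wpM2r.
have Ipq : U.-integrable setT (EFin \o (fun t => psi t * q t)).
  exact: (@integrable_boundedM _ _ _ U psi q _ mpsi psi_norm Iq).
rewrite -(EFin_Rintegral Ipq); apply: (le_trans (lee_abs _)).
apply: (le_trans (le_abse_integral U measurableT (measurable_int U Ipq))).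
apply: ge0_le_integral => //.
- exact: (measurableT_comp _ (measurable_int U Ipq)).
- apply: (measurable_fun_fubini_tonelli_G (m1 := U)
    (fun z => (green z.1 z.2 * (`|q z.1| * `|q z.2|))%:E)).
  + apply/measurable_EFinP; apply: measurable_funM.
      exact: (measurable_green measurable_fst measurable_snd).
    by apply: measurable_funM; apply: measurableT_comp => //; exact: measurableT_comp.
  + by move=> z; rewrite lee_fin !(normr_ge0, green_ge0, mulr_ge0).
move=> t _; rewrite /= normrM EFinM muleC.
have mgq : measurable_fun setT (EFin \o (fun s => green s t * q s)).
  exact: (measurable_int U (Igq t)).
rewrite (EFin_normr_Rintegral measurableT (Igq t)).
apply: (@le_trans _ _ (`|q t|%:E * \int[U]_s `|(green s t * q s)%:E|)%E).
  by rewrite lee_wpmul2l ?lee_fin // le_abse_integral.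
rewrite -ge0_integralZl_EFin //; last exact: measurableT_comp.
rewrite le_eqVlt; apply/orP; left; apply/eqP; apply: eq_integral => s _.
rewrite -EFinM; congr EFin.
by rewrite normrM (ger0_norm (green_ge0 s t)); ring.
Qed.

(** Pythagoras: the cross term is 2 c times the mean of the primitive, which is zero. Later c is the
    value of an average on the line. *)
Lemma sqr_primitive_le q c : measurable_fun setT q ->
  (\int[U]_x ((primitive q x + c) ^+ 2)%:E <=
   (pi^-2)%:E * \int[U]_t (q t ^+ 2)%:E + (c ^+ 2)%:E)%E.
Proof.
move=> mq.
have [|qoo] := leP +oo%E (\int[U]_t (q t ^+ 2)%:E)%E.
  rewrite leye_eq => /eqP ->; rewrite gt0_muley ?lte_fin ?invr_gt0 ?exprn_gt0 ?pi_gt0 //.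
  by rewrite addye // leey.
have Iq := L2_integrable mq qoo.
pose m := \int[U]_y running q y.
have mr := measurable_running mq.
have Ir : U.-integrable setT (EFin \o running q).
  apply: (@integrable_bounded _ _ _ U (running q) _ mr).
  exact: running_bounded.
pose f x := running q x - m.
pose C := \int[U]_t `|q t| + `|m|.
have fC x : `|f x| <= C.
  by rewrite (le_trans (ler_normB _ _)) // lerD2r; exact: running_bounded.
have If : U.-integrable setT (EFin \o f).
  apply: (@integrable_bounded _ _ _ U f C) => //; exact: measurable_funB.
have If2 : U.-integrable setT (EFin \o (fun x => f x ^+ 2)).
  by apply: (@integrable_boundedM _ _ _ U f f C) => //; exact: measurable_funB.
have f0 : \int[U]_x f x = 0.
  rewrite RintegralB //; last exact: (finite_measure_integrable_cst U m measurableT).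
  by rewrite Rintegral_unit_cst subrr.
have Ifc : U.-integrable setT (EFin \o (fun x => (f x + c) ^+ 2)).
  have Ic := finite_measure_integrable_cst U (c ^+ 2) measurableT.
  have I2 := integrableZl measurableT (2 * c) If.
  have := integrableD measurableT (integrableD measurableT If2 I2) Ic.
  by apply: eq_integrable => // x _ /=; rewrite -!EFinD; congr EFin; ring.
(* [primitiveE] is available only inside (0, 1), a set of full measure. *)
have -> : (\int[U]_x ((primitive q x + c) ^+ 2)%:E = \int[U]_x ((f x + c) ^+ 2)%:E)%E.
  apply: ae_eq_integral => //.
  - apply/measurable_EFinP; apply: measurable_funX; apply: measurable_funD => //.
    exact: measurable_primitive1.
  - exact: (measurable_int U Ifc).
  - by apply: (ae_imply (@unit_leb_ae R)) => x x01 _; rewrite primitiveE.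
rewrite (EFin_Rintegral Ifc) (Rintegral_shift_sqr _ If If2) f0 mulr0 addr0 EFinD.
rewrite leeD2r // sqr_centered_running //.
apply: le_trans (green_schur mq).
exact: green_form_le.
Qed.

End unit_L2.

(** * Operators on the cube *)

Lemma ge0_integral_eq0_ae d (T : measurableType d) (R : realType)
    (mu : {measure set T -> \bar R}) (g : T -> \bar R) :
  measurable_fun setT g -> (forall x, 0 <= g x)%E ->
  (\int[mu]_x g x = 0)%E -> {ae mu, forall x, g x = 0%E}.
Proof.
move=> mg g0 I0; have [+ _] := ae_eq_integral_abs mu measurableT mg.
under eq_integral do rewrite gee0_abs //.
by move=> /(_ I0); apply: filterS => x; exact.
Qed.

Section cube_operators.
Variables (R : realType) (d : nat).
Notation U := (unit_leb R).
Notation Q := (lebesgue_cube R d).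
Implicit Types (u v : Rn R d -> R) (i : 'I_d) (x : Rn R d).

(** The squared norm is kept in the extended reals so that operator bounds can be chained before
    finiteness is known. *)
Definition energy u : \bar R := (\int[Q]_x (u x ^+ 2)%:E)%E.

Lemma energy_ge0 u : (0 <= energy u)%E.
Proof. by apply: integral_ge0 => x _; rewrite lee_fin sqr_ge0. Qed.

Lemma set_coordK i s t x : set_coord i s (set_coord i t x) = set_coord i s x.
Proof.
by apply: eq_from_tnth => j; rewrite !tnth_mktuple; case: (j == i).
Qed.

Lemma tnth_set_coord i t x : tnth (set_coord i t x) i = t.
Proof. by rewrite tnth_mktuple eqxx. Qed.

Lemma primitive_coord_set i u t x : primitive_coord i u (set_coord i t x) =
  primitive (fun s => u (set_coord i s x)) t.
Proof.
rewrite /primitive_coord tnth_set_coord; congr (primitive _ t).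
by apply/funext => s; rewrite set_coordK.
Qed.

Lemma average_coord_set i u t x :
  average_coord i u (set_coord i t x) = average_coord i u x.
Proof. by apply: eq_Rintegral => s _; rewrite set_coordK. Qed.

Lemma primitive_coord0 i : primitive_coord i (0 : Rn R d -> R) = 0.
Proof.
apply/funext => x; rewrite /primitive_coord /primitive.
have z (D : set (measurableTypeR R)) : \int[lebesgue_measure]_(t in D) (0 : R) = 0.
  by rewrite /Rintegral integral0.
rewrite z; under eq_Rintegral do rewrite z.
by rewrite z subr0.
Qed.

Lemma average_coord0 i : average_coord i (0 : Rn R d -> R) = 0.
Proof. by apply/funext => x; rewrite /average_coord /Rintegral integral0. Qed.

Lemma measurable_coord_line u i : measurable_fun setT u ->
  measurable_fun setT (fun z : Rn R d * measurableTypeR R => u (set_coord i z.2 z.1)).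
Proof. by move=> mu; apply: (measurableT_comp mu); exact: measurable_set_coord. Qed.

Lemma measurable_line u i x : measurable_fun setT u ->
  measurable_fun setT (fun t : measurableTypeR R => u (set_coord i t x)).
Proof.
move=> mu; exact: (measurableT_comp (measurable_coord_line i mu) (measurable_pair1 x)).
Qed.

Lemma measurable_primitive_coord i u : measurable_fun setT u ->
  measurable_fun setT (primitive_coord i u).
Proof.
move=> mu; apply: (measurable_primitive (measurable_coord_line i mu)).
exact: measurable_tnth.
Qed.

Lemma average_coordE i u x : measurable_fun setT u ->
  average_coord i u x = \int[U]_t u (set_coord i t x).
Proof. by move=> mu; rewrite -Rintegral_unitE //; exact: measurable_line. Qed.

Lemma measurable_average_coord i u : measurable_fun setT u ->
  measurable_fun setT (average_coord i u).
Proof.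
move=> mu.
have -> : average_coord i u = fun x => \int[U]_t u (set_coord i t x).
  by apply/funext => x; rewrite average_coordE.
exact: (measurable_Rintegral U (measurable_coord_line i mu)).
Qed.

Lemma measurable_sqr u : measurable_fun setT u ->
  measurable_fun setT (fun x => (u x ^+ 2)%:E).
Proof. by move=> mu; apply/measurable_EFinP; exact: measurable_funX. Qed.

Lemma energy_slice i u : measurable_fun setT u ->
  energy u = (\int[Q]_x \int[U]_t (u (set_coord i t x) ^+ 2)%:E)%E.
Proof.
move=> mu; apply: (ge0_integral_slice i (measurable_sqr mu)) => x.
by rewrite lee_fin sqr_ge0.
Qed.

Lemma measurable_slice_energy i u : measurable_fun setT u ->
  measurable_fun setT (fun x => \int[U]_t (u (set_coord i t x) ^+ 2)%:E)%E.
Proof.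
move=> mu; apply: (measurable_slice_integral i (measurable_sqr mu)) => x.
by rewrite lee_fin sqr_ge0.
Qed.

Lemma slice_energy_ge0 i u x : (0 <= \int[U]_t (u (set_coord i t x) ^+ 2)%:E)%E.
Proof. by apply: integral_ge0 => t _; rewrite lee_fin sqr_ge0. Qed.

Lemma energy_average i u : measurable_fun setT u ->
  (energy (average_coord i u) <= energy u)%E.
Proof.
move=> mu; rewrite (energy_slice i mu); apply: ge0_le_integral => //.
- by move=> x _; rewrite lee_fin sqr_ge0.
- by apply: measurable_sqr; exact: measurable_average_coord.
- exact: measurable_slice_energy.
- by move=> x _; apply: sqr_average_le; exact: measurable_line.
Qed.

(* On each line in direction i, the primitive has mean zero while the average
   is constant, hence the two terms are orthogonal. *)
Lemma energy_primitive_average i u v :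
  measurable_fun setT u -> measurable_fun setT v ->
  (energy (primitive_coord i u + average_coord i v)%R <=
   (pi^-2)%:E * energy u + energy v)%E.
Proof.
move=> mu mv.
have mp := measurable_primitive_coord i mu; have ma := measurable_average_coord i mv.
have pi0 : 0 <= (pi : R)^-2 by rewrite invr_ge0 sqr_ge0.
apply: (@le_trans _ _ ((pi^-2)%:E * energy u + energy (average_coord i v))%E); last first.
  by rewrite leeD2l // energy_average.
(* The energy of the average is deliberately left unsliced: its integrand at x is already the
   [c ^+ 2] of [sqr_primitive_le] on the line through x. *)
rewrite (energy_slice i); last exact: measurable_funD.
rewrite (energy_slice i mu) -ge0_integralZl_EFin //; last 2 first.
- by move=> x _; exact: slice_energy_ge0.
- exact: measurable_slice_energy.
rewrite -ge0_integralD //; last 4 first.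
- by move=> x _; rewrite mule_ge0 ?lee_fin // slice_energy_ge0.
- by apply: measurable_funeM; exact: measurable_slice_energy.
- by move=> x _; rewrite lee_fin sqr_ge0.
- exact: measurable_sqr.
apply: ge0_le_integral => //.
- by move=> x _; exact: slice_energy_ge0.
- by apply: measurable_slice_energy; exact: measurable_funD.
- apply: emeasurable_funD; last exact: measurable_sqr.
  by apply: measurable_funeM; exact: measurable_slice_energy.
- move=> x _; under eq_integral do
    rewrite /GRing.add /= primitive_coord_set average_coord_set.
  by apply: sqr_primitive_le; exact: measurable_line.
Qed.

Lemma energy_primitive i u : measurable_fun setT u ->
  (energy (primitive_coord i u) <= (pi^-2)%:E * energy u)%E.
Proof.
move=> mu; have m0 : measurable_fun setT (0 : Rn R d -> R) by exact: measurable_cst.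
have e0 : energy 0 = 0%E.
  by apply: integral0_eq => x _; rewrite /= expr0n.
by have := energy_primitive_average i mu m0; rewrite average_coord0 addr0 e0 adde0.
Qed.

(** Slice the indicator of a null set: its line integrals are nonnegative with total integral zero,
    hence vanish for almost every line. *)
Lemma ae_line i (P : Rn R d -> Prop) : {ae Q, forall x, P x} ->
  {ae Q, forall x, {ae U, forall t, P (set_coord i t x)}}.
Proof.
move=> [N [mN N0 PN]].
pose g x : \bar R := (\1_N x)%:E.
have mg : measurable_fun setT g.
  by apply/measurable_EFinP; exact: measurable_indic.
have g0 x : (0 <= g x)%E by rewrite lee_fin indicE.
have I0 : (\int[Q]_x \int[U]_t g (set_coord i t x) = 0)%E.
  rewrite -(ge0_integral_slice i mg g0) -N0 -[in RHS](setIT N).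
  exact: integral_indic.
have gi0 x : (0 <= \int[U]_t g (set_coord i t x))%E by exact: integral_ge0.
have h := ge0_integral_eq0_ae (measurable_slice_integral i mg g0) gi0 I0.
apply: (ae_imply h) => x Ix.
have mgx : measurable_fun setT (fun t : measurableTypeR R => g (set_coord i t x)).
  exact: (measurableT_comp (measurable_slice i mg) (measurable_pair1 x)).
apply: (ae_imply (ge0_integral_eq0_ae mgx (fun t => g0 _) Ix)) => t gt0.
apply: contrapT => nP; have Nt : N (set_coord i t x) by exact: PN.
by move: gt0; rewrite /g indicE mem_set // => -[] /eqP; rewrite oner_eq0.
Qed.

Lemma ae_line_L2 i u : measurable_fun setT u -> (energy u < +oo)%E ->
  {ae Q, forall x, U.-integrable setT (fun t => (u (set_coord i t x))%:E)}.
Proof.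
move=> mu; rewrite (energy_slice i mu) => Eoo.
have I : Q.-integrable setT (fun x => \int[U]_t (u (set_coord i t x) ^+ 2)%:E)%E.
  apply/integrableP; split; first exact: measurable_slice_energy.
  by under eq_integral do rewrite gee0_abs ?slice_energy_ge0 //.
apply: (ae_imply (integrable_ae measurableT I)) => x /(_ Logic.I).
rewrite ge0_fin_numE ?slice_energy_ge0 // => oo.
by apply: (@L2_integrable R (fun t => u (set_coord i t x))) => //; exact: measurable_line.
Qed.

(** Finite energy makes each term integrable on almost every line, and only there is the average
    additive. [ae_line] transfers the identity for g to those lines. *)
Lemma average_coord_sum_ae i n (f : 'I_n -> Rn R d -> R) (g : Rn R d -> R) :
  (forall k, measurable_fun setT (f k)) -> (forall k, energy (f k) < +oo)%E ->
  measurable_fun setT g -> {ae Q, forall x, \sum_(k < n) f k x = g x} ->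
  {ae Q, forall x, \sum_(k < n) average_coord i (f k) x = average_coord i g x}.
Proof.
move=> mf Ef mg fg.
have aeI : {ae Q, forall x, forall k : 'I_n,
    U.-integrable setT (fun t => (f k (set_coord i t x))%:E)}.
  apply: filter_forall => k.
  exact: ae_line_L2.
have := ae_line i fg; apply: filterS2 aeI => x Ix fgx.
rewrite average_coordE //; under eq_bigr do rewrite average_coordE //.
have -> : \int[U]_t g (set_coord i t x) = \int[U]_t \sum_(k < n) f k (set_coord i t x).
  congr fine; apply: ae_eq_integral => //.
  - by apply/measurable_EFinP; exact: measurable_line.
  - by apply/measurable_EFinP; apply: measurable_sum => k; exact: measurable_line.
  - by apply: (ae_imply fgx) => t ht _; rewrite ht.
rewrite /Rintegral; under [in RHS]eq_integral do rewrite -sumEFin.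
rewrite integral_sum // -sum_fine //.
by move=> k _; exact: integrable_fin_num.
Qed.

End cube_operators.

(** * Nested sums of primitives and averages *)

Section horner_form.
Variables (R : realType) (d : nat).
Notation Q := (lebesgue_cube R d).
Variable u : 'I_d -> Rn R d -> R.
Hypothesis mu : forall i, measurable_fun setT (u i).
Hypothesis uoo : forall i, (energy (u i) < +oo)%E.

Fixpoint horner_form (s : seq 'I_d) : Rn R d -> R :=
  if s is i :: s' then
    primitive_coord i (u i) + average_coord i (horner_form s')
  else 0.

Lemma measurable_horner_form s : measurable_fun setT (horner_form s).
Proof.
elim: s => [|i s IH]; first exact: measurable_cst.
apply: measurable_funD; first exact: measurable_primitive_coord.
exact: measurable_average_coord.
Qed.

Lemma energy_horner_form s :
  (energy (horner_form s) <= \sum_(i <- s) (pi^-2)%:E * energy (u i))%E.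
Proof.
elim: s => [|i s IH].
  by rewrite big_nil /energy integral0_eq // => x _; rewrite /= expr0n.
rewrite big_cons; apply: le_trans (leeD2l _ IH).
by apply: energy_primitive_average => //; exact: measurable_horner_form.
Qed.

Definition averages (s : seq 'I_d) (v : Rn R d -> R) :=
  foldr (@average_coord R d) v s.

Lemma measurable_averages s v : measurable_fun setT v ->
  measurable_fun setT (averages s v).
Proof. by move=> mv; elim: s => //= i s; exact: measurable_average_coord. Qed.

Lemma energy_averages s v : measurable_fun setT v ->
  (energy (averages s v) <= energy v)%E.
Proof.
move=> mv; elim: s => //= i s; apply: le_trans.
by apply: energy_average; exact: measurable_averages.
Qed.

Lemma energy_primitive_lty i : (energy (primitive_coord i (u i)) < +oo)%E.
Proof.
apply: le_lt_trans (energy_primitive i (mu i)) _.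
by rewrite lte_mul_pinfty ?lee_fin ?invr_ge0 ?sqr_ge0.
Qed.

(** Each entry of s pulls one average out of the remaining sum, at the cost of a null set. The left
    side has the shape in which H is defined; the right side is the one that can be estimated. *)
Lemma sum_averages_ae i0 s : {ae Q, forall x,
  \sum_(k < size s)
    averages (take k s) (primitive_coord (nth i0 s k) (u (nth i0 s k))) x =
  horner_form s x}.
Proof.
elim: s => [|i s IH] /=.
  by apply: aeW => x; rewrite big_ord0.
pose g (k : 'I_(size s)) :=
  averages (take k s) (primitive_coord (nth i0 s k) (u (nth i0 s k))).
have mg k : measurable_fun setT (g k).
  by apply: measurable_averages; exact: measurable_primitive_coord.
have goo k : (energy (g k) < +oo)%E.
  apply: le_lt_trans (energy_primitive_lty (nth i0 s k)).
  by apply: energy_averages; exact: measurable_primitive_coord.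
have := average_coord_sum_ae i mg goo (measurable_horner_form s) IH.
by apply: filterS => x Hx; rewrite big_ord_recl /= /GRing.add /= -Hx.
Qed.

End horner_form.

(** Group the pairs (J, i) by their union. A fibre contains at most one pair, since i must be the
    minimum of the union and J the rest; injectivity and nonnegativity give the inequality. *)
Lemma sum_setU1_le (R : realDomainType) d l (e : {set 'I_d} -> R) :
  (0 < l)%N -> (forall I, 0 <= e I) ->
  \sum_(J : {set 'I_d} | #|J| == l.-1)
    \sum_(i < d | [forall j in J, (i < j)%N]) e (i |: J) <=
  \sum_(I : {set 'I_d} | #|I| == l) e I.
Proof.
move=> l0 e0; rewrite pair_big_dep /=.
pose P (p : {set 'I_d} * 'I_d) := (#|p.1| == l.-1) && [forall j in p.1, (p.2 < j)%N].
have notin p : P p -> p.2 \notin p.1.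
  by move=> /andP[_ /forall_inP H]; apply/negP => /H; rewrite ltnn.
rewrite (partition_big (fun p => p.2 |: p.1) (fun I => #|I| == l)) /=; last first.
  move=> p Pp; rewrite cardsU1 notin //.
  by case/andP: Pp => /eqP -> _; rewrite add1n prednK.
apply: ler_sum => I _.
case: (pickP (fun p => P p && (p.2 |: p.1 == I)))
    => [p /andP[Pp /eqP pI]|none]; last first.
  by rewrite big_pred0.
rewrite (bigD1 p) /=; last by rewrite pI eqxx andbT.
rewrite pI big1 ?addr0 // => p' /andP[/andP[Pp' /eqP p'I]] /eqP; case.
(* Each of the two indices lies in the other's union and is at least its minimum; applied both ways,
   this forces equality. *)
have min_le q q' : P q -> P q' -> q.2 |: q.1 = q'.2 |: q'.1 -> (q'.2 <= q.2)%N.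
  move=> Pq /andP[_ /forall_inP H] qq'.
  have : q.2 \in q'.2 |: q'.1 by rewrite -qq' setU11.
  by rewrite in_setU1 => /orP[/eqP -> //|/H /ltnW].
have e2 : p'.2 = p.2.
  by apply/val_inj/eqP; rewrite eqn_leq !min_le // pI p'I.
have e1 : p'.1 = p.1.
  by rewrite -(setU1K (notin _ Pp)) -(setU1K (notin _ Pp')) e2 pI -p'I e2.
by case: p p' e1 e2 {pI p'I Pp Pp'} => [? ?] [? ?] /= -> ->.
Qed.

(** * Energies and the library's L^2 norms *)

Section L2_forms.
Variables (R : realType) (d : nat).
Implicit Types (v : Rn R d -> R).

Lemma Lnorm_energy v :
  ('N[lebesgue_cube R d]_2%:E[EFin \o v] `^ 2 = energy v)%E.
Proof.
rewrite powR_Lnorm //; apply: eq_integral => x _.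
by rewrite /= powR_mulrn // real_normK ?num_real.
Qed.

Lemma Lnorm_fin v : (energy v < +oo)%E ->
  ('N[lebesgue_cube R d]_2%:E[EFin \o v] < +oo)%E.
Proof.
rewrite -Lnorm_energy ltey => h; rewrite ltey; apply: contra h => /eqP ->.
by rewrite poweRyr.
Qed.

Lemma fine_Lnorm_sqr v : (energy v < +oo)%E ->
  fine 'N[lebesgue_cube R d]_2%:E[EFin \o v]%E ^+ 2 = fine (energy v).
Proof.
move=> voo; rewrite -Lnorm_energy.
have N0 := Lnorm_ge0 (lebesgue_cube R d) 2%:E (EFin \o v).
have := Lnorm_fin voo; case: ('N[_]__[_])%E N0 => [r|//|//] r0 _ /=.
by rewrite powR_mulrn.
Qed.

Lemma Lfun_energyP v : v \in Lfun (lebesgue_cube R d) 2%:E <->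
  measurable_fun setT v /\ (energy v < +oo)%E.
Proof.
split.
  move=> vL; have := sub_Lfun_mfun vL; rewrite inE => mv; split => //.
  have /integrableP[_] := Lfun2_integrable_sqr vL.
  by under eq_integral do rewrite /= ger0_norm ?sqr_ge0 //.
by move=> [mv voo]; apply/andP; split; rewrite inE //; exact: Lnorm_fin.
Qed.

End L2_forms.

(** * Differential forms *)

Section forms.
Variables (R : realType) (d : nat).
Implicit Types (w v : dform R d) (i j : 'I_d) (I J : {set 'I_d}).

Lemma sum_formE (T : finType) (F : T -> dform R d) J :
  (\sum_t F t) J = \sum_t F t J.
Proof. by elim/big_rec2: _ => // t x y _ <-. Qed.

Lemma p_opE j v J :
  p_op j v J = if j \in J then 0 else average_coord j (v J).
Proof.
rewrite /p_op sum_formE (bigD1 J) //= big1 => [|I IJ].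
  by rewrite addr0; case: ifP => // _; rewrite /monomial eqxx.
by case: ifP => // _; rewrite /monomial eq_sym (negbTE IJ).
Qed.

(** The only I containing i with [I :\ i] equal to J is [i |: J], and it qualifies exactly when i is
    not in J. *)
Lemma h_opE i w J :
  h_op i w J = if i \in J then 0 else
    (-1) ^+ #|[set j in i |: J | (j < i)%N]| *: primitive_coord i (w (i |: J)).
Proof.
rewrite /h_op sum_formE; case: ifPn => iJ.
  rewrite big1 // => I _; case: ifP => // iI; rewrite /monomial.
  by case: eqP => // JI; move: iJ; rewrite JI in_setD1 eqxx.
rewrite (bigD1 (i |: J)) //= setU11 big1 => [|I IJ].
  by rewrite addr0 /monomial setU1K // eqxx.
case: ifP => // iI; rewrite /monomial; case: eqP => // JI.
by move: IJ; rewrite JI finset.setD1K // eqxx.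
Qed.

Lemma foldr_p_opE s v J : foldr (@p_op R d) v s J =
  if has (mem J) s then 0 else averages s (v J).
Proof.
elim: s => //= j s IH; rewrite p_opE IH; case: (j \in J) => //=.
by case: ifP => // _; rewrite average_coord0.
Qed.

Lemma averages0 s : averages s (0 : Rn R d -> R) = 0.
Proof. by elim: s => //= j s ->; exact: average_coord0. Qed.

(** Gives the index list of [p_below] the prefix form that [sum_averages_ae] produces. Both lists
    are strictly sorted with the same members. *)
Lemma filter_enum_ord i :
  [seq j : 'I_d <- enum 'I_d | (j < i)%N] = take i (enum 'I_d).
Proof.
apply: (inj_map val_inj); rewrite map_take val_enum_ord.
rewrite -(filter_map val (fun k => k < i)%N) val_enum_ord.
rewrite take_iota (minn_idPl (ltnW (ltn_ord i))).
apply: (irr_sorted_eq ltn_trans ltnn).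
- by rewrite sorted_filter ?iota_ltn_sorted //; exact: ltn_trans.
- exact: iota_ltn_sorted.
- move=> k; rewrite mem_filter !mem_iota !add0n /= andb_idr // => ki.
  exact: ltn_trans ki (ltn_ord i).
Qed.

(** The default 0 lets a single [horner_form] run over all of [enum 'I_d]; for empty J every i
    satisfies the condition. *)
Definition lowered w J i : Rn R d -> R :=
  if [forall j in J, (i < j)%N] then w (i |: J) else 0.

(** If i is below all of J, no earlier p_j meets an index of J, and i comes first in [i |: J], so
    the sign exponent is 0. Otherwise some j <= i lies in J: for j = i, h_i yields no dx_J term, and
    for j < i, p_j kills it. *)
Lemma H_op_term w J i : p_below i (h_op i w) J =
  averages (take i (enum 'I_d)) (primitive_coord i (lowered w J i)).
Proof.
rewrite /p_below filter_enum_ord foldr_p_opE h_opE /lowered.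
rewrite -filter_enum_ord.
have [/forall_inP lt_iJ|] := boolP [forall j in J, (i < j)%N].
  rewrite ifF; last first.
    apply/negbTE/hasPn => j; rewrite mem_filter => /andP[ji _] /=.
    by apply/negP => /lt_iJ; rewrite ltnNge ltnW.
  rewrite ifF; last by apply/negbTE/negP => /lt_iJ; rewrite ltnn.
  rewrite (_ : [set _ in _ | _] = finset.set0) ?cards0 ?scale1r //.
  apply/setP => j; rewrite !inE; case: (altP (j =P i)) => [->|_] /=.
    by rewrite ltnn.
  by apply/negP => /andP[/lt_iJ]; rewrite ltnNge => /negP ij /ltnW.
case/forall_inPn => j jJ; rewrite -leqNgt leq_eqVlt => /predU1P[ji|ji].
  have -> : i = j by exact/val_inj.
  by rewrite jJ primitive_coord0 !averages0 if_same.
rewrite primitive_coord0 averages0 ifT //.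
by apply/hasP; exists j => //; rewrite mem_filter ji mem_enum.
Qed.

Lemma H_op_ae w J (i0 : 'I_d) :
  (forall i, measurable_fun setT (lowered w J i)) ->
  (forall i, energy (lowered w J i) < +oo)%E ->
  {ae lebesgue_cube R d, forall x,
    H_op w J x = horner_form (lowered w J) (enum 'I_d) x}.
Proof.
move=> mlow low_oo; have := sum_averages_ae mlow low_oo i0 (enum 'I_d).
apply: filterS => x <-; rewrite /H_op sum_formE fct_sumE.
rewrite -(big_mkord predT (fun k => averages (take k (enum 'I_d))
   (primitive_coord (nth i0 (enum 'I_d) k) (lowered w J (nth i0 (enum 'I_d) k))) x)).
rewrite size_enum_ord big_mkord; apply: eq_bigr => i _.
by rewrite H_op_term nth_ord_enum.
Qed.

Lemma measurable_H_op w J : (forall i, measurable_fun setT (lowered w J i)) ->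
  measurable_fun setT (H_op w J).
Proof.
move=> mlow.
have -> : H_op w J = fun x => \sum_(i < d) p_below i (h_op i w) J x.
  by apply/funext => x; rewrite /H_op sum_formE fct_sumE.
apply: measurable_sum => i; rewrite H_op_term.
by apply: measurable_averages; exact: measurable_primitive_coord.
Qed.

(** [L2form] asks for exact vanishing in the other degrees, so the argument goes term by term
    instead of through the almost everywhere identity. *)
Lemma H_op_eq0 l w J : (forall I, #|I| <> l -> w I = 0) -> #|J| <> l.-1 ->
  H_op w J = 0.
Proof.
move=> wl Jl; rewrite /H_op sum_formE big1 // => i _; rewrite H_op_term /lowered.
case: ifP => [/forall_inP lt_iJ|_]; last by rewrite primitive_coord0 averages0.
rewrite wl ?primitive_coord0 ?averages0 // cardsU1.
rewrite (_ : i \notin J) ?add1n => [Jl'|]; first by apply: Jl; rewrite -Jl'.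
by apply/negP => /lt_iJ; rewrite ltnn.
Qed.

End forms.

Theorem lemma5p2 (R : realType) (d l : nat) (hd : (1 <= d)%N)
    (hl : (1 <= l <= d)%N) (w : dform R d) (hw : L2form l w) :
  L2form l.-1 (H_op w) /\ L2norm l.-1 (H_op w) <= pi^-1 * L2norm l w.
Proof.
have /andP[l0 _] := hl; have i0 : 'I_d by case: d hd {hl w hw} => // n _; exact: ord0.
have [wL w0] := hw.
have zero_ok : measurable_fun setT (0 : Rn R d -> R) /\
    (energy (0%R : Rn R d -> R) < +oo)%E.
  split; first exact: measurable_cst.
  by rewrite /energy integral0_eq ?ltry // => x _; rewrite /= expr0n.
have wI I : measurable_fun setT (w I) /\ (energy (w I) < +oo)%E.
  by have [Il|/eqP/w0 -> //] := eqVneq #|I| l; apply/Lfun_energyP; exact: wL.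
have mlow J i : measurable_fun setT (lowered w J i).
  by rewrite /lowered; case: ifP => _; [exact: (wI _).1|exact: zero_ok.1].
have low_oo J i : (energy (lowered w J i) < +oo)%E.
  by rewrite /lowered; case: ifP => _; [exact: (wI _).2|exact: zero_ok.2].
pose e I : R := fine (energy (w I)).
have e0 I : 0 <= e I by rewrite fine_ge0 // energy_ge0.
have pi0 : 0 <= (pi : R)^-2 by rewrite invr_ge0 sqr_ge0.
have HJ J : (energy (H_op w J) <=
    (pi^-2 * \sum_(i < d | [forall j in J, (i < j)%N]) e (i |: J))%:E)%E.
  have -> : energy (H_op w J) = energy (horner_form (lowered w J) (enum 'I_d)).
    apply: ae_eq_integral => //.
    - by apply: measurable_sqr; exact: measurable_H_op.
    - by apply: measurable_sqr; exact: measurable_horner_form.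
    - by apply: filterS (H_op_ae i0 (mlow J) (low_oo J)) => x -> _.
  apply: le_trans (energy_horner_form (mlow J) _) _.
  (* The conditional sum becomes a sum over all i with zero terms, matching [lowered], whose energy
     is 0 when the condition fails. *)
  rewrite big_enum /= [X in _ * X]big_mkcond mulr_sumr -sumEFin (eq_bigl xpredT) //.
  apply: lee_sum => i _.
  rewrite /lowered; case: ifP => _; last first.
    by rewrite mulr0 /energy integral0_eq ?mule0 // => x _; rewrite /= expr0n.
  by rewrite EFinM /e fineK // ge0_fin_numE ?energy_ge0 //; exact: (wI _).2.
have Hoo J : (energy (H_op w J) < +oo)%E by exact: le_lt_trans (HJ J) (ltry _).
split.
  split=> [J Jl|J Jl].
    by apply/Lfun_energyP; split; [exact: measurable_H_op|].
  exact: H_op_eq0 Jl.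
rewrite /L2norm.
under eq_bigr do rewrite fine_Lnorm_sqr //.
under [in leRHS]eq_bigr do rewrite (fine_Lnorm_sqr (wI _).2).
have pig0 : 0 <= (pi : R)^-1 by rewrite invr_ge0 pi_ge0.
(* pi^-1 is absorbed into the square root as its square, which reduces the claim to the sums of
   squared norms. *)
rewrite -{1}(ger0_norm pig0) -sqrtr_sqr -sqrtrM ?sqr_ge0 // ler_sqrt; last first.
  by rewrite mulr_ge0 ?sqr_ge0 // sumr_ge0 // => I _; exact: e0.
apply: le_trans (ler_wpM2l (sqr_ge0 _) (sum_setU1_le l0 e0)).
rewrite mulr_sumr; apply: ler_sum => J _; rewrite exprVn.
by rewrite -lee_fin fineK // ge0_fin_numE ?energy_ge0.
Qed.
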